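(* Let $N\geq 1$ and $a=X_0<X_1<\dots<X_N=b$, and let $\Omega_i=[X_i,X_{i+1}]$ for $0\leq i\leq N-1$. For functions $u_i:\Omega_i\to\mathbb{R}$ ($0\leq i\leq N-1$) consider the $C^0$ continuity conditions $$(\ast)\qquad u_i(X_{i+1})=u_{i+1}(X_{i+1}),\qquad 0\leq i\leq N-2,$$ and the expressions, for $x\in\Omega_i$ and $0\leq i\leq N-1$, $$(\ast\ast)\qquad u_i(x)=g_i(x)+[\alpha_i-g_i(X_i)]\,\phi_0(X_i,X_{i+1},x)+[\alpha_{i+1}-g_i(X_{i+1})]\,\phi_1(X_i,X_{i+1},x).$$ (i) For arbitrary functions $g_i:\Omega_i\to\mathbb{R}$ ($0\leq i\leq N-1$) and arbitrary values of the parameters $\alpha_i\in\mathbb{R}$ ($0\leq i\leq N$), the functions $u_i$ given by $(\ast\ast)$ satisfy $(\ast)$. (ii) Any set of functions $u_i:\Omega_i\to\mathbb{R}$ ($0\leq i\leq N-1$) satisfying $(\ast)$ can be expressed in the form $(\ast\ast)$ for some $g_i:\Omega_i\to\mathbb{R}$ ($0\leq i\leq N-1$) and some values of the parameters $\alpha_i$ ($0\leq i\leq N$).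
   Context: For real numbers $s<t$: $\phi_0(s,t,x)=\dfrac{t-x}{t-s}$ and $\phi_1(s,t,x)=\dfrac{x-s}{t-s}$. *)

(* Defs.v *)
From HB Require Import structures.
From mathcomp Require Import all_boot all_order all_algebra reals.
Set Implicit Arguments.
Unset Strict Implicit.
Unset Printing Implicit Defensive.
Import Order.TTheory GRing.Theory Num.Theory.
Local Open Scope ring_scope.

Definition phi0 (R : realType) (s t x : R) : R := (t - x) / (t - s).
Definition phi1 (R : realType) (s t x : R) : R := (x - s) / (t - s).

(* The N subintervals are indexed by 'I_N and the N + 1 knots by 'I_N.+1:
   the endpoints of interval i are the knots of index i and i + 1. *)
Definition lknot (N : nat) (i : 'I_N) : 'I_N.+1 := widen_ord (leqnSn N) i.
Definition rknot (N : nat) (i : 'I_N) : 'I_N.+1 := lift ord0 i.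

Definition Omega (R : realType) (N : nat) (X : 'I_N.+1 -> R) (i : 'I_N) :
    interval R :=
  `[X (lknot i), X (rknot i)].

(* A function on Omega X i is represented by a total function R -> R of which
   only the values on Omega X i are ever used. *)

Definition C0_conditions (R : realType) (N : nat) (X : 'I_N.+1 -> R)
    (u : 'I_N -> R -> R) : Prop :=
  forall i j : 'I_N, j = i.+1 :> nat ->
    u i (X (rknot i)) = u j (X (rknot i)).

Definition expressed_by (R : realType) (N : nat) (X : 'I_N.+1 -> R)
    (u g : 'I_N -> R -> R) (alpha : 'I_N.+1 -> R) : Prop :=
  forall (i : 'I_N) (x : R), x \in Omega X i ->
    u i x = g i x
      + (alpha (lknot i) - g i (X (lknot i)))
          * phi0 (X (lknot i)) (X (rknot i)) x
      + (alpha (rknot i) - g i (X (rknot i)))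
          * phi1 (X (lknot i)) (X (rknot i)) x.

(* Main.v *)
Require Import Defs.
From HB Require Import structures.
From mathcomp Require Import all_boot all_order all_algebra reals.
Set Implicit Arguments.
Unset Strict Implicit.
Unset Printing Implicit Defensive.
Import Order.TTheory GRing.Theory Num.Theory.
Local Open Scope ring_scope.

(** In the expression of [u i], the correction added to [g i] is the affine
    function whose values at the two endpoints are the defects
    [alpha - g i]; hence [u i] takes the values [alpha (lknot i)] and
    [alpha (rknot i)] at the endpoints, whatever [g] is
    ([expressed_by_lknot], [expressed_by_rknot]).  Two consecutive pieces share
    a knot, so they agree there: this is (i).  For (ii), take [g := u] and let
    [alpha] be the common values of the pieces at the knots ([knot_value]); all
    the defects vanish and the expression reduces to [u i x = u i x]. *)

Section Phi.
Variables (R : realType) (s t : R).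

Lemma phi0_right : phi0 s t t = 0.
Proof. by rewrite /phi0 subrr mul0r. Qed.

Lemma phi1_left : phi1 s t s = 0.
Proof. by rewrite /phi1 subrr mul0r. Qed.

Hypothesis lt_st : s < t.

Lemma phi0_left : phi0 s t s = 1.
Proof. by rewrite /phi0 divff // subr_eq0 gt_eqF. Qed.

Lemma phi1_right : phi1 s t t = 1.
Proof. by rewrite /phi1 divff // subr_eq0 gt_eqF. Qed.

End Phi.

Lemma lknot_succ (N : nat) (i j : 'I_N) :
  j = i.+1 :> nat -> lknot j = rknot i.
Proof. by move=> ji; apply: val_inj; rewrite /= ji. Qed.

Section EndpointValues.
Variables (R : realType) (N : nat) (X : 'I_N.+1 -> R).
Variables (u g : 'I_N -> R -> R) (alpha : 'I_N.+1 -> R) (i : 'I_N).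
Hypotheses (ltX : X (lknot i) < X (rknot i)) (ug : expressed_by X u g alpha).

Lemma expressed_by_lknot : u i (X (lknot i)) = alpha (lknot i).
Proof.
rewrite ug; last by rewrite in_itv /= lexx ltW.
by rewrite phi0_left // phi1_left mulr1 mulr0 addr0 addrC subrK.
Qed.

Lemma expressed_by_rknot : u i (X (rknot i)) = alpha (rknot i).
Proof.
rewrite ug; last by rewrite in_itv /= lexx ltW.
by rewrite phi0_right phi1_right // mulr1 mulr0 addr0 addrC subrK.
Qed.

End EndpointValues.

(** The value at knot [k] of a family of pieces: it is read off the interval
    ending at [k], or off the first interval when [k] is the first knot. *)
Definition knot_value (R : realType) (N : nat) (X : 'I_N.+2 -> R)
    (u : 'I_N.+1 -> R -> R) (k : 'I_N.+2) : R :=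
  if unlift ord0 k is Some i then u i (X k) else u ord0 (X k).

Lemma knot_value_rknot (R : realType) (N : nat) (X : 'I_N.+2 -> R)
    (u : 'I_N.+1 -> R -> R) (i : 'I_N.+1) :
  knot_value X u (rknot i) = u i (X (rknot i)).
Proof. by rewrite /knot_value liftK. Qed.

(** Only here are the continuity conditions needed: the left endpoint of an
    interval other than the first is the right endpoint of the previous one. *)
Lemma knot_value_lknot (R : realType) (N : nat) (X : 'I_N.+2 -> R)
    (u : 'I_N.+1 -> R -> R) (i : 'I_N.+1) :
  C0_conditions X u -> knot_value X u (lknot i) = u i (X (lknot i)).
Proof.
move=> uC0; have [j ij|i0] := unliftP ord0 (lknot i).
  have ji : i = j.+1 :> nat by move/(congr1 val): ij.
  by rewrite (lknot_succ ji) knot_value_rknot; apply: uC0.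
have -> : i = ord0 by apply: val_inj; move/(congr1 val): i0.
have -> : lknot (ord0 : 'I_N.+1) = ord0 by apply: val_inj.
by rewrite /knot_value unlift_none.
Qed.

Theorem theorem4 (R : realType) (N : nat) (a b : R) (X : 'I_N.+1 -> R)
    (hN : (1 <= N)%N) (hXa : X ord0 = a) (hXb : X ord_max = b)
    (hX : forall i : 'I_N, X (lknot i) < X (rknot i)) :
  (forall (g : 'I_N -> R -> R) (alpha : 'I_N.+1 -> R) (u : 'I_N -> R -> R),
      expressed_by X u g alpha -> C0_conditions X u)
  /\
  (forall u : 'I_N -> R -> R,
      C0_conditions X u ->
      exists (g : 'I_N -> R -> R) (alpha : 'I_N.+1 -> R),
        expressed_by X u g alpha).
Proof.
split=> [g alpha u ug i j ji|u uC0].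
  rewrite (expressed_by_rknot (hX i) ug) -(lknot_succ ji).
  by rewrite (expressed_by_lknot (hX j) ug).
(* The hypothesis [1 <= N] provides the first interval read by [knot_value]. *)
case: N hN X hXa hXb hX u uC0 => // n _ Y _ _ _ u uC0.
exists u, (knot_value Y u) => i x _.
by rewrite knot_value_lknot // knot_value_rknot !subrr !mul0r !addr0.
Qed.
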